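(* Let $n\ge2$, let $X\subseteq\mathbb{R}^n$ be open, and let $G\colon X\times U\to X$ be such that for every $w\in U$ the map $G(\cdot,w)$ is a $C^1$-diffeomorphism onto an open subset of $X$ and is of class $C^{1,1}$. Let $\psi$ denote the general solution of $x_{k+1}=G(x_k,u_k)$, let $N\in\mathbb{N}$, $r>0$, and let $\Omega\subseteq X$ be $r$-convex with $\Omega\neq\mathbb{R}^n$. Assume that there are $L_1,L_2\in\mathbb{R}$ such that $$L_1\ge \alpha_+(D_1G(x,w))^2/\alpha_-(D_1G(x,w)),$$ $$L_2\ge\limsup_{h\to0}\frac{\|D_1G(x,w)^{-1}D_1G(x+h,w)-\mathrm{id}\|}{\|h\|}$$ for all $(x,w)\in\psi([0;N[,\Omega,U^{\mathbb{Z}_+})\times U\subseteq X\times U$. Then the attainable set $\psi(k,\Omega,u)$ is convex for all $k\in[0;N]$ and all $u\colon\mathbb{Z}_+\to U$ if $$rL_2\sum_{\tau=0}^{N-1}L_1^\tau\le1.$$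
   Context: $\mathbb{Z}_+=\{0,1,2,\dots\}$; $[a;b]$, $[a;b[$ denote the sets of integers $j$ with $a\le j\le b$, resp. $a\le j<b$. $\|\cdot\|$ is the Euclidean norm of vectors and the induced norm of linear maps; $\alpha_+(A)$ and $\alpha_-(A)$ are the maximum and minimum singular values of $A$; $D_1G$ is the partial derivative of $G$ with respect to its first argument; $\mathrm{id}$ is the identity. $C^{1,1}$ is the class of $C^1$ maps with locally Lipschitz continuous derivative. General solution: $\psi(0,x_0,u)=x_0$, $\psi(k+1,x_0,u)=G(\psi(k,x_0,u),u_k)$ for $u\colon\mathbb{Z}_+\to U$. Set arguments are understood pointwise, e.g. $\psi(k,\Omega,u)=\{\psi(k,x,u):x\in\Omega\}$ and $\psi([0;N[,\Omega,U^{\mathbb{Z}_+})=\{\psi(k,x,u):k\in[0;N[,x\in\Omega,u\in U^{\mathbb{Z}_+}\}$. A set $\Omega\subseteq\mathbb{R}^n$ is $r$-convex ($r>0$) if it is the intersection of a family of closed Euclidean balls of radius $r$, i.e. $\Omega=\bigcap_{x\in M}\bar B(x,r)$ for some $M\subseteq\mathbb{R}^n$. *)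

(* Defs.v *)
From HB Require Import structures.
From mathcomp Require Import all_boot all_order all_algebra.
From mathcomp Require Import all_classical all_reals all_analysis.

Set Implicit Arguments.
Unset Strict Implicit.
Unset Printing Implicit Defensive.

Import Order.TTheory GRing.Theory Num.Theory.
Import numFieldNormedType.Exports.

Local Open Scope classical_set_scope.
Local Open Scope ring_scope.

(* Points of R^n are row vectors and a matrix A stands for the linear map
   v |-> v *m A, the convention of [jacobian]: 'd f x v = v *m jacobian f x.
   Hence composition of maps is reversed in products: S o T is T *m S, and the
   adjoint composite A^* o A is A *m A^T. *)

(* [`|v|] is the sup norm on 'rV[R]_n; it induces the same topology and the
   same differentials, but metric statements need the Euclidean norm. *)
Definition enorm (R : realType) (n : nat) (v : 'rV[R]_n) : R :=
  Num.sqrt (\sum_(i < n) v 0 i ^+ 2).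

Definition opnorm (R : realType) (n : nat) (A : 'M[R]_n) : R :=
  sup [set enorm (v *m A) | v in [set v : 'rV[R]_n | enorm v <= 1]].

Definition singular_values (R : realType) (n : nat) (A : 'M[R]_n) : set R :=
  [set Num.sqrt l | l in [set l : R | eigenvalue (A *m A^T) l]].

(* The set of singular values is finite, and nonempty when 0 < n, so that
   these are its maximum and its minimum. *)
Definition alpha_max (R : realType) (n : nat) (A : 'M[R]_n) : R :=
  sup (singular_values A).

Definition alpha_min (R : realType) (n : nat) (A : 'M[R]_n) : R :=
  inf (singular_values A).

(* The next three definitions are meant for open sets A, B. The values of f
   outside A are then irrelevant. *)
Definition C1_on (R : realType) (n : nat) (A : set 'rV[R]_n)
    (f : 'rV[R]_n -> 'rV[R]_n) : Prop :=
  forall x, A x -> differentiable f x /\ {for x, continuous (jacobian f)}.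

Definition C11_on (R : realType) (n : nat) (A : set 'rV[R]_n)
    (f : 'rV[R]_n -> 'rV[R]_n) : Prop :=
  C1_on A f /\
  forall x, A x -> exists K : R, \forall y & z \near x,
    opnorm (jacobian f y - jacobian f z) <= K * enorm (y - z).

Definition C1_diffeo (R : realType) (n : nat) (A B : set 'rV[R]_n)
    (f : 'rV[R]_n -> 'rV[R]_n) : Prop :=
  [/\ set_bij A B f, C1_on A f &
      exists2 g : 'rV[R]_n -> 'rV[R]_n, {in A, cancel f g} & C1_on B g].

Definition r_convex (R : realType) (n : nat) (r : R) (Omega : set 'rV[R]_n) :
    Prop :=
  exists M : set 'rV[R]_n,
    Omega = \bigcap_(x in M) [set y | enorm (y - x) <= r].

Fixpoint psi (T U : Type) (G : T -> U -> T) (k : nat) (x0 : T) (u : nat -> U) :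
    T :=
  if k is j.+1 then G (psi G j x0 u) (u j) else x0.

(* psi([0;N[, Omega, U^{Z_+}) *)
Definition psi_before (T U : Type) (G : T -> U -> T) (N : nat)
    (Omega : set T) : set T :=
  [set x | exists k x0 u, [/\ (k < N)%N, Omega x0 & x = psi G k x0 u]].

(* Main.v *)
Require Import Defs.
From HB Require Import structures.
From mathcomp Require Import all_boot all_order all_algebra.
From mathcomp Require Import all_classical all_reals all_analysis.
From mathcomp Require Import ring lra.

(** Fix [k] and [u], let [f := psi G k ^~ u], and let [M] be the set of centers
    of the balls of radius [r] whose intersection is [Omega].

    The derivative of [f] satisfies at every point [x] of [Omega]
    [|f'(x)^-1 f'(x + h) - 1| <= (L + o(1)) |h|] with
    [L := L2 (1 + L1 + ... + L1^(k-1))]. This follows by induction on [k] from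
    the chain rule ([jacobian_lip_comp], [psi_jacobian_lip]): composing with
    one more step [g], of constant [L2], adds [L2 |P|^2 |P^-1|] to the
    constant, where [P = f'(x)]. The product of the bounds by singular values
    of the single steps gives [|P|^2 |P^-1| <= L1^k]. By hypothesis
    [r L <= 1].

    The inverse image under [f] of a segment with direction [v] is a curve
    with velocity [q' = v f'(q)^-1], and the estimate above bounds its
    curvature by [L <= 1 / r] at its points in [Omega]. For [c] in [M] and [q]
    in [Omega], half the second derivative of [|q - c|^2] is
    [|q'|^2 + <q - c, q''> >= (1 - r L) |q'|^2 >= 0]. Hence [|q - c|^2] is a
    convex function, so that a curve which lies in [Omega] and whose endpoints
    have distance at most [rho] from [c] stays at distance at most [rho]
    ([curve_in_ball], [segment_image_ball_cap]). As [q''] need not exist, the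
    convexity is derived from a Dini derivative of [<q - c, q'>].

    It remains to see that the inverse image of the segment from [f x] to
    [f y] exists and lies in [Omega]. Suppose first that [x] and [y] belong to
    the intersection [Omega'] of the balls of some radius [rho < r] with
    centers in [M]. [Omega] is a neighborhood of each point of [Omega']. Let
    [y] run along a segment, starting from [x]. If at some moment the segment
    between the images is contained in [f (Omega')], it is contained in
    [f (Omega)] for some time, hence in [f (Omega')] by the preceding
    paragraph. The property also is preserved under limits as [f (Omega')] is
    compact, so it holds all the time ([segment_image_inner]). For arbitrary
    [x != y] in [Omega] the inner points of the segment from [x] to [y] belong
    to sets [Omega'], because balls are strictly convex, and [f x], [f y] are
    limits of their images ([segment_image]). *)

Set Implicit Arguments.
Unset Strict Implicit.
Unset Printing Implicit Defensive.

Import Order.TTheory GRing.Theory Num.Theory.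
Import numFieldNormedType.Exports.

Local Open Scope classical_set_scope.
Local Open Scope ring_scope.

(** * Euclidean geometry of row vectors *)

Definition dot {R : realType} {n : nat} (u v : 'rV[R]_n) : R :=
  \sum_(i < n) u 0 i * v 0 i.

Section Euclidean.
Context {R : realType} {n : nat}.
Implicit Types (u v w x y : 'rV[R]_n) (a b c : R).

Lemma dotC u v : dot u v = dot v u.
Proof. by apply: eq_bigr => i _; rewrite mulrC. Qed.

Lemma dotDl u v w : dot (u + v) w = dot u w + dot v w.
Proof. by rewrite -big_split; apply: eq_bigr => i _; rewrite mxE mulrDl. Qed.

Lemma dotZl a u v : dot (a *: u) v = a * dot u v.
Proof. by rewrite mulr_sumr; apply: eq_bigr => i _; rewrite mxE mulrA. Qed.

Lemma dotDr u v w : dot u (v + w) = dot u v + dot u w.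
Proof. by rewrite dotC dotDl !(dotC _ u). Qed.

Lemma dotZr a u v : dot u (a *: v) = a * dot u v.
Proof. by rewrite dotC dotZl dotC. Qed.

Lemma dotNl u v : dot (- u) v = - dot u v.
Proof. by rewrite -scaleN1r dotZl mulN1r. Qed.

Lemma dotNr u v : dot u (- v) = - dot u v.
Proof. by rewrite dotC dotNl dotC. Qed.

Definition dotE := (dotDl, dotDr, dotNl, dotNr, dotZl, dotZr).

Lemma dot0l v : dot 0 v = 0.
Proof. by rewrite -(scale0r v) dotZl mul0r. Qed.

Lemma dot_ge0 v : 0 <= dot v v.
Proof. by apply: sumr_ge0 => i _; rewrite -expr2 sqr_ge0. Qed.

Lemma sqr_enorm v : enorm v ^+ 2 = dot v v.
Proof.
rewrite /enorm sqr_sqrtr; last by apply: sumr_ge0 => i _; rewrite sqr_ge0.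
by apply: eq_bigr => i _; rewrite expr2.
Qed.

Lemma enorm_ge0 v : 0 <= enorm v.
Proof. exact: sqrtr_ge0. Qed.

Lemma enorm_le v c : 0 <= c -> dot v v <= c ^+ 2 -> enorm v <= c.
Proof. by move=> c0; rewrite -sqr_enorm ler_pXn2r // nnegrE // enorm_ge0. Qed.

Lemma dot_le_sqr v c : enorm v <= c -> dot v v <= c ^+ 2.
Proof.
move=> vc; rewrite -sqr_enorm ler_pXn2r // nnegrE ?enorm_ge0 //.
by apply: le_trans vc; exact: enorm_ge0.
Qed.

Lemma coord_le_enorm v i : `|v 0 i| <= enorm v.
Proof.
rewrite -[leLHS]ger0_norm ?normr_ge0// -ler_sqr ?nnegrE ?enorm_ge0 //.
rewrite sqr_enorm ger0_norm // -normrX ger0_norm ?sqr_ge0 // /dot (bigD1 i) //=.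
by rewrite -expr2 lerDl; apply: sumr_ge0 => j _; rewrite -expr2 sqr_ge0.
Qed.

Lemma norm_le_enorm v : `|v| <= enorm v.
Proof.
rewrite [leLHS]/Num.Def.normr/= mx_normrE.
rewrite (bigmax_le _ (enorm_ge0 v)) //= => -[j i] _ /=.
by rewrite (ord1 j) coord_le_enorm.
Qed.

Lemma enorm_eq0 v : enorm v = 0 -> v = 0.
Proof.
move=> v0; apply/eqP; rewrite -normr_le0; rewrite -v0; exact: norm_le_enorm.
Qed.

Lemma enorm0 : enorm (0 : 'rV[R]_n) = 0.
Proof.
by apply/le_anti/andP; split; rewrite ?enorm_ge0 // enorm_le // dot0l expr0n.
Qed.

Lemma enormZ a v : enorm (a *: v) = `|a| * enorm v.
Proof.
apply/(@pexpIrn _ 2) => //; rewrite ?nnegrE ?mulr_ge0 ?enorm_ge0 //.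
by rewrite exprMn !sqr_enorm !dotE real_normK ?num_real // expr2 mulrA.
Qed.

Lemma enormN v : enorm (- v) = enorm v.
Proof. by rewrite -scaleN1r enormZ normrN1 mul1r. Qed.

Lemma enormBC u v : enorm (u - v) = enorm (v - u).
Proof. by rewrite -enormN opprB. Qed.

(** Cauchy-Schwarz, from [0 <= dot w w] for [w := |v| u - |u| v]. *)
Lemma dot_le u v : dot u v <= enorm u * enorm v.
Proof.
have [u0|u0] := eqVneq (enorm u) 0.
  by rewrite u0 (enorm_eq0 u0) dot0l mul0r.
have [v0|v0] := eqVneq (enorm v) 0.
  by rewrite v0 (enorm_eq0 v0) dotC dot0l mulr0.
have up : 0 < enorm u by rewrite lt_def u0 enorm_ge0.
have vp : 0 < enorm v by rewrite lt_def v0 enorm_ge0.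
have := dot_ge0 (enorm v *: u - enorm u *: v).
rewrite !dotE -!sqr_enorm (dotC v u) => H.
rewrite -(@ler_pM2l _ (enorm u * enorm v)) ?mulr_gt0 //; nra.
Qed.

Lemma dot_geN u v : - (enorm u * enorm v) <= dot u v.
Proof. by rewrite lerNl -dotNl -(enormN u) dot_le. Qed.

Lemma enormD u v : enorm (u + v) <= enorm u + enorm v.
Proof.
apply: enorm_le; first by rewrite addr_ge0 ?enorm_ge0.
rewrite !dotE (dotC v u) -!sqr_enorm; have := dot_le u v; nra.
Qed.

Lemma enorm_sum m (f : 'I_m -> 'rV[R]_n) :
  enorm (\sum_i f i) <= \sum_i enorm (f i).
Proof.
elim/big_ind2 : _ => //; first by rewrite enorm0.
by move=> x1 x2 y1 y2 h1 h2; apply: le_trans (enormD _ _) _; apply: lerD.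
Qed.

Lemma enorm_le_norm v : enorm v <= n%:R * `|v|.
Proof.
apply: enorm_le; first by rewrite mulr_ge0.
apply: (@le_trans _ _ (\sum_(i < n) `|v| ^+ 2)).
  apply: ler_sum => i _; rewrite -expr2 -(real_normK (num_real (v 0 i))).
  rewrite ler_sqr ?nnegrE //.
  by rewrite [leRHS]/Num.Def.normr/= mx_normrE (le_bigmax _ _ (0, i)).
rewrite sumr_const card_ord -[leLHS]mulr_natl exprMn.
apply: ler_wpM2r; first exact: sqr_ge0.
by rewrite -natrX ler_nat; case: (n) => // m; rewrite -[leqLHS]muln1 leq_pmul2l.
Qed.

Lemma near_enorm_lt x e : 0 < e -> \forall y \near x, enorm (y - x) < e.
Proof.
move=> e0; have n0 : 0 < n.+1%:R :> R by rewrite ltr0Sn.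
near=> y; apply: le_lt_trans (enorm_le_norm _) _.
have : `|y - x| < e / n.+1%:R.
  rewrite distrC; suff : ball x (e / n.+1%:R) y by rewrite -ball_normE.
  by near: y; apply: nbhsx_ballx; rewrite divr_gt0.
rewrite ltr_pdivlMr // mulrC; apply: le_lt_trans.
by rewrite ler_wpM2r // ler_nat.
Unshelve. all: by end_near. Qed.

Lemma cvg_enormP T (F : set_system T) (FF : Filter F) (f : T -> 'rV[R]_n) x :
  (forall e, 0 < e -> \forall t \near F, enorm (f t - x) < e) <->
  f @ F --> x.
Proof.
split => [h|h e e0].
  apply/cvgrPdist_lt => e e0; near=> t; rewrite distrC.
  by apply: le_lt_trans (norm_le_enorm _) _; near: t; apply: h.
exact: (h _ (near_enorm_lt x e0)).
Unshelve. all: by end_near. Qed.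

Lemma enorm_continuous : continuous (@enorm R n).
Proof.
move=> x; apply/(@cvgrPdist_lt _ _ _ (nbhs x) (nbhs_filter x)) => e e0.
near=> y.
apply: (@le_lt_trans _ _ (enorm (y - x))); last first.
  by near: y; exact: near_enorm_lt.
have h1 := enormD (x - y) y; have h2 := enormD (y - x) x.
rewrite !subrK in h1 h2; rewrite enormBC in h1.
by rewrite ler_norml; apply/andP; split; lra.
Unshelve. all: by end_near. Qed.

Lemma cvg_dot T (F : set_system T) (FF : Filter F)
    (f g : T -> 'rV[R]_n) x y :
  f @ F --> x -> g @ F --> y -> dot (f t) (g t) @[t --> F] --> dot x y.
Proof.
move=> fx gy; apply: cvg_big => [|i _]; first exact: add_continuous.
have ci z : {for z, continuous (fun v : 'rV[R]_n => v 0 i)}.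
  exact: coord_continuous.
apply: cvgM.
  exact: (continuous_cvg FF (ci x) fx).
exact: (continuous_cvg FF (ci y) gy).
Qed.

End Euclidean.
(** * Operator norm and singular values *)

Section Matrices.
Context {R : realType} {n : nat}.
Implicit Types (v w : 'rV[R]_n) (A S : 'M[R]_n).

Lemma enorm_mulmx_bounded A :
  exists C, forall v, enorm (v *m A) <= C * enorm v.
Proof.
exists (\sum_i enorm (row i A)) => v.
rewrite mulmx_sum_row; apply: le_trans (enorm_sum _) _.
rewrite mulr_suml; apply: ler_sum => i _.
by rewrite enormZ mulrC ler_wpM2l ?enorm_ge0 // coord_le_enorm.
Qed.

Lemma mulmx_continuous A : continuous (fun v => v *m A).
Proof.
have [C HC] := enorm_mulmx_bounded A.
move=> v; apply/(cvg_enormP (nbhs_filter v)) => e e0; near=> w.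
have C0 : 0 < `|C| + 1 by rewrite ltr_pwDr.
rewrite -mulmxBl; apply: le_lt_trans (HC _) _.
apply: (@le_lt_trans _ _ ((`|C| + 1) * enorm (w - v))).
  rewrite ler_wpM2r ?enorm_ge0 //; have := ler_norm C; lra.
rewrite mulrC -ltr_pdivlMr //; near: w; apply: near_enorm_lt.
by rewrite divr_gt0.
Unshelve. all: by end_near. Qed.

Lemma le_opnorm A v : enorm (v *m A) <= opnorm A * enorm v.
Proof.
have [C HC] := enorm_mulmx_bounded A.
have [v0|v0] := eqVneq (enorm v) 0.
  by rewrite (enorm_eq0 v0) mul0mx enorm0 mulr0.
have vp : 0 < enorm v by rewrite lt_def v0 enorm_ge0.
rewrite -ler_pdivrMr //.
have -> : enorm (v *m A) / enorm v = enorm (((enorm v)^-1 *: v) *m A).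
  by rewrite -scalemxAl enormZ gtr0_norm ?invr_gt0 // mulrC.
apply: sup_ubound; last first.
  exists ((enorm v)^-1 *: v) => //=.
  by rewrite enormZ gtr0_norm ?invr_gt0 // mulVf.
exists `|C| => _ [w /= w1 <-]; apply: le_trans (HC _) _.
apply: (@le_trans _ _ (`|C| * enorm w)).
  by rewrite ler_wpM2r ?enorm_ge0 // ler_norm.
by rewrite -[leRHS]mulr1 ler_wpM2l.
Qed.

Lemma dot_mulmxl A v w : dot (v *m A) w = dot v (w *m A^T).
Proof.
have dE (x y : 'rV[R]_n) : dot x y = (x *m y^T) 0 0.
  by rewrite mxE; apply: eq_bigr => i _; rewrite mxE.
by rewrite !dE trmx_mul trmxK mulmxA.
Qed.

Lemma unit_sphere_compact : compact [set v : 'rV[R]_n | enorm v = 1].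
Proof.
apply: bounded_closed_compact.
  exists 1; split; first exact: num_real.
  move=> M M1 v /= v1; apply: le_trans (norm_le_enorm _) _.
  by rewrite v1 ltW.
have -> : [set v : 'rV[R]_n | enorm v = 1] = @enorm R n @^-1` [set 1] by [].
apply: preimage_closed; last exact: closed_eq.
by move=> x _; exact: enorm_continuous.
Qed.

(** If [c] maximizes the Rayleigh quotient and [l] is the maximum, then
    [q v := l |v|^2 - <v S, v>] is nonnegative and vanishes at [c]. With
    [w := c (l - S)], the inequality [q (c - t w) >= 0] for all [t] forces the
    first order term [- 2 t |w|^2] to vanish, so [w = 0]. *)
Lemma max_Rayleigh S : (0 < n)%N -> S^T = S ->
  exists2 l, eigenvalue S l & forall v, dot (v *m S) v <= l * dot v v.
Proof.
move=> n0 St.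
have S0 : [set v : 'rV[R]_n | enorm v = 1] !=set0.
  pose d : 'rV[R]_n := delta_mx 0 (Ordinal n0).
  exists ((enorm d)^-1 *: d) => /=.
  have dp : 0 < enorm d.
    rewrite lt_def enorm_ge0 andbT; apply/eqP => /enorm_eq0 /matrixP.
    move=> /(_ 0 (Ordinal n0)) /eqP; rewrite !mxE !eqxx.
    by rewrite oner_eq0.
  by rewrite enormZ gtr0_norm ?invr_gt0 // mulVf ?gt_eqF.
have fc : {within [set v : 'rV[R]_n | enorm v = 1],
    continuous (fun v => dot (v *m S) v)}.
  apply: continuous_subspaceT => v.
  apply: (cvg_dot (nbhs_filter v)); last exact: cvg_id.
  exact: mulmx_continuous.
have [c c1 cmax] := EVT_max_rV S0 unit_sphere_compact fc.
move: c1; rewrite inE /= => c1.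
set l := dot (c *m S) c in cmax.
have lP v : dot (v *m S) v <= l * dot v v.
  have [v0|v0] := eqVneq (enorm v) 0.
    by rewrite (enorm_eq0 v0) mul0mx !dot0l mulr0.
  have vp : 0 < enorm v by rewrite lt_def v0 enorm_ge0.
  have := cmax ((enorm v)^-1 *: v).
  rewrite inE /= enormZ gtr0_norm ?invr_gt0 // mulVf // => /(_ erefl).
  rewrite -scalemxAl !dotE mulrA -expr2 exprVn mulrC ler_pdivrMr ?exprn_gt0 //.
  by rewrite sqr_enorm.
exists l => //; apply/eigenvalueP; exists c; last first.
  apply/eqP => c0; move: c1; rewrite c0 enorm0 => /eqP.
  by rewrite eq_sym oner_eq0.
pose w : 'rV[R]_n := l *: c - c *m S.
have cc : dot c c = 1 by rewrite -sqr_enorm c1 expr1n.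
have cS : dot (c *m S) w = dot (w *m S) c by rewrite dot_mulmxl St dotC.
have wE : dot w w = l * dot c w - dot (c *m S) w.
  by rewrite -[LHS]/(dot (l *: c - c *m S) w) dotDl dotNl dotZl.
suff w0 : w = 0 by apply/eqP; rewrite eq_sym -subr_eq0 -/w w0.
clearbody w.
have q t : 2 * t * dot w w <= t ^+ 2 * (l * dot w w - dot (w *m S) w).
  have := lP (c - t *: w).
  rewrite mulmxBl -scalemxAl !dotE (dotC w c) cc wE -cS -/l; lra.
set Q := l * dot w w - dot (w *m S) w in q.
have Q0 : 0 <= Q by rewrite subr_ge0.
have [->//|wn0] := eqVneq w 0.
have wp : 0 < dot w w.
  rewrite -sqr_enorm exprn_gt0 // lt_def enorm_ge0 andbT.
  by apply: contra wn0 => /eqP /enorm_eq0 ->.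
have Q1 : 0 < Q + 1 by rewrite ltr_pwDr.
have sp : 0 < dot w w / (Q + 1) by rewrite divr_gt0.
have sQ : dot w w / (Q + 1) * (Q + 1) = dot w w by rewrite divfK ?gt_eqF.
move: sp sQ (q (dot w w / (Q + 1))); set s := _ / (Q + 1) => sp sQ.
have -> : s ^+ 2 * Q = s * (dot w w - s) by rewrite -sQ; ring.
move=> h; have : 0 < s * (dot w w + s) by rewrite mulr_gt0 ?addr_gt0.
by rewrite ltNge => /negP[]; lra.
Qed.

Section Singular_values.
Variable A : 'M[R]_n.
Hypothesis n_gt0 : (0 < n)%N.

Let dotAAT v : dot (v *m (A *m A^T)) v = dot (v *m A) (v *m A).
Proof. by rewrite mulmxA dot_mulmxl trmxK. Qed.

Let AAT_sym : (A *m A^T)^T = A *m A^T.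
Proof. by rewrite trmx_mul trmxK. Qed.

Let eigenvalue_dot l : eigenvalue (A *m A^T) l ->
  exists2 v, 0 < dot v v & l * dot v v = dot (v *m A) (v *m A).
Proof.
move=> /eigenvalueP[v vl v0]; exists v.
  rewrite -sqr_enorm exprn_gt0 // lt_def enorm_ge0 andbT.
  by apply: contra v0 => /eqP /enorm_eq0 ->.
by rewrite -dotAAT vl dotZl.
Qed.

Lemma enorm_mulmx_le_alpha_max v : enorm (v *m A) <= alpha_max A * enorm v.
Proof.
have [l el lP] := max_Rayleigh n_gt0 AAT_sym.
have lmax : Num.sqrt l <= alpha_max A.
  apply: sup_ubound; last by exists l.
  exists (Num.sqrt l) => _ [m /= /eigenvalue_dot[w w0 wm] <-].
  by rewrite ler_wsqrtr // -(ler_pM2r w0) wm -dotAAT.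
apply: (@le_trans _ _ (Num.sqrt l * enorm v)).
  apply: enorm_le; first by rewrite mulr_ge0 ?enorm_ge0 ?sqrtr_ge0.
  have [w w0 wl] := eigenvalue_dot el.
  have l0 : 0 <= l by rewrite -(pmulr_lge0 _ w0) wl dot_ge0.
  by rewrite exprMn sqr_sqrtr // sqr_enorm -dotAAT.
by rewrite ler_wpM2r ?enorm_ge0.
Qed.

Lemma alpha_max_ge0 : 0 <= alpha_max A.
Proof.
have [l el _] := max_Rayleigh n_gt0 AAT_sym.
have := enorm_mulmx_le_alpha_max; case/eigenvalue_dot: el => v v0 _ /(_ v) h.
have vp : 0 < enorm v.
  rewrite lt_def enorm_ge0 andbT; apply/eqP => /enorm_eq0 ve.
  by move: v0; rewrite ve dot0l ltxx.
by rewrite -(pmulr_lge0 _ vp); apply: le_trans h; exact: enorm_ge0.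
Qed.

Let min_Rayleigh : exists2 m, eigenvalue (A *m A^T) m &
  forall v, m * dot v v <= dot (v *m A) (v *m A).
Proof.
have [|l /eigenvalueP[w wl w0] lP] := @max_Rayleigh (- (A *m A^T)) n_gt0.
  by rewrite linearN /= AAT_sym.
exists (- l) => [|v].
  apply/eigenvalueP; exists w => //.
  by rewrite scaleNr -wl mulmxN opprK.
by have := lP v; rewrite mulmxN dotNl dotAAT; lra.
Qed.

Lemma alpha_min_le_enorm_mulmx v : alpha_min A * enorm v <= enorm (v *m A).
Proof.
have [m em mP] := min_Rayleigh.
have lmin : alpha_min A <= Num.sqrt m.
  apply: inf_lbound; last by exists m.
  by exists 0 => _ [l _ <-]; exact: sqrtr_ge0.
apply: (@le_trans _ _ (Num.sqrt m * enorm v)).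
  by rewrite ler_wpM2r ?enorm_ge0.
have [w w0 wl] := eigenvalue_dot em.
have m0 : 0 <= m by rewrite -(pmulr_lge0 _ w0) wl dot_ge0.
rewrite -ler_sqr ?nnegrE ?mulr_ge0 ?enorm_ge0 ?sqrtr_ge0 //.
by rewrite exprMn sqr_sqrtr // !sqr_enorm.
Qed.

Lemma alpha_min_gt0 : A \in unitmx -> 0 < alpha_min A.
Proof.
move=> uA; have [m em mP] := min_Rayleigh.
have [w w0 wl] := eigenvalue_dot em.
have m0 : 0 < m.
  rewrite -(pmulr_lgt0 _ w0) wl -sqr_enorm exprn_gt0 // lt_def enorm_ge0 andbT.
  apply/eqP => /enorm_eq0 wA0.
  by move: w0; rewrite -[w](mulmxK uA) wA0 mul0mx dot0l ltxx.
apply: (@lt_le_trans _ _ (Num.sqrt m)); first by rewrite sqrtr_gt0.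
apply: lb_le_inf; first by exists (Num.sqrt m), m.
move=> _ [l /= /eigenvalue_dot[u u0 ul] <-].
by rewrite ler_wsqrtr // -(ler_pM2r u0) ul.
Qed.

End Singular_values.

(** A form of [|A|^2 |A^-1| <= c] in terms of bounds that are multiplicative
    in [A]. *)
Definition distortion_le A c := exists a b, [/\ 0 <= a, 0 < b, a ^+ 2 / b <= c,
  forall v, enorm (v *m A) <= a * enorm v &
  forall v, b * enorm v <= enorm (v *m A)].

Lemma distortion_ge0 A c : distortion_le A c -> 0 <= c.
Proof.
move=> [a [b [_ b0 ab _ _]]]; apply: le_trans ab.
by rewrite divr_ge0 ?sqr_ge0 // ltW.
Qed.

Lemma distortion1 : distortion_le 1%:M 1.
Proof.
exists 1, 1; split=> //; first by rewrite expr1n divr1.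
  by move=> v; rewrite mulmx1 mul1r.
by move=> v; rewrite mulmx1 mul1r.
Qed.

Lemma distortion_mulmx A B c d : distortion_le A c -> distortion_le B d ->
  distortion_le (A *m B) (d * c).
Proof.
move=> [a [b [a0 b0 ab aA bA]]] [a' [b' [a'0 b'0 a'b' aB bB]]].
exists (a' * a), (b' * b); split.
- exact: mulr_ge0.
- exact: mulr_gt0.
- have -> : (a' * a) ^+ 2 / (b' * b) = (a' ^+ 2 / b') * (a ^+ 2 / b).
    by rewrite invfM; ring.
  by apply: ler_pM => //; rewrite divr_ge0 ?sqr_ge0 // ltW.
- move=> v; rewrite mulmxA; apply: le_trans (aB _) _.
  by rewrite -mulrA ler_wpM2l.
- move=> v; rewrite mulmxA; apply: le_trans (bB _).
  by rewrite -mulrA ler_pM2l.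
Qed.

Lemma distortion_singular_values A c : (0 < n)%N -> A \in unitmx ->
  alpha_max A ^+ 2 / alpha_min A <= c -> distortion_le A c.
Proof.
move=> n0 uA Ac; exists (alpha_max A), (alpha_min A); split => //.
- exact: alpha_max_ge0.
- exact: alpha_min_gt0.
- by move=> v; exact: enorm_mulmx_le_alpha_max.
- by move=> v; exact: alpha_min_le_enorm_mulmx.
Qed.

End Matrices.
(** * Curves of bounded curvature in a ball *)

Section Real_line.
Context {R : realType}.
Implicit Types (a b e s t u : R).

(** The supremum [m] of the points up to which [P] holds satisfies [P] by the
    third hypothesis, hence [m = b] by the second one. *)
Lemma real_induction a b (P : R -> Prop) :
  P a ->
  (forall t, a <= t < b -> P t -> \forall s \near t^'+, P s) ->
  (forall t, a < t <= b -> (forall s, a <= s < t -> P s) -> P t) ->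
  forall t, a <= t <= b -> P t.
Proof.
move=> Pa Popen Pclosed.
pose E := [set t | a <= t <= b /\ forall s, a <= s <= t -> P s].
have [ab|ba] := leP a b; last first.
  by move=> t /andP[at_ tb]; move: (lt_le_trans ba at_); rewrite ltNge tb.
have Ea : E a.
  split; first by rewrite lexx.
  by move=> s /andP[as_ sa]; have -> : s = a by apply/le_anti/andP.
have supE : has_sup E.
  by split; [exists a|exists b => t [/andP[]]].
pose m := sup E.
have am : a <= m by apply: sup_upper_bound.
have mb : m <= b by apply: ge_sup; [exists a|move=> t [/andP[]]].
have Plt s : a <= s < m -> P s.
  move=> /andP[as_ sm].
  have e0 : 0 < m - s by rewrite subr_gt0.
  have [t [tab tP] st] := sup_adherent e0 supE.
  by rewrite -/m subKr in st; apply: tP; rewrite as_ ltW.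
have Pm : P m.
  have [<-//|/eqP am'] := eqVneq a m.
  by apply: Pclosed Plt; rewrite mb lt_neqAle am !andbT; apply/eqP.
have Em s : a <= s <= m -> P s.
  move=> /andP[as_]; rewrite le_eqVlt => /predU1P[->//|sm].
  by apply: Plt; rewrite as_.
have [->|mb'] := eqVneq b m; first exact: Em.
have {}mb' : m < b by rewrite lt_neqAle eq_sym mb' mb.
exfalso; have [|d d0 dP] := Popen m _ Pm; first by rewrite am.
pose d' := Num.min (d / 2) (b - m).
have d'0 : 0 < d' by rewrite lt_min divr_gt0 // subr_gt0.
suff : E (m + d') by move=> /(sup_upper_bound supE); rewrite -/m; lra.
have d'b : d' <= b - m by rewrite ge_min lexx orbT.
have d'd : d' <= d / 2 by rewrite ge_min lexx.
split; first by apply/andP; split; lra.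
move=> s /andP[as_ sd].
have [sm|ms] := leP s m; first by apply: Em; rewrite as_.
apply: dP => //=.
by rewrite ltr_norml; apply/andP; split; move: d0 => /= d0; lra.
Qed.

(** For each [e > 0] the inequality [g a <= g t + e (t - a)] propagates to the
    right of [t] by the hypothesis on [g], and to left limits by continuity. *)
Lemma nondecreasing_of_Dini (g : R -> R) a b : a <= b ->
  (forall t, a <= t <= b -> {for t, continuous g}) ->
  (forall t e, a <= t < b -> 0 < e ->
    \forall s \near t^'+, - (e * (s - t)) <= g s - g t) ->
  g a <= g b.
Proof.
move=> ab gc gD; apply/ler_addgt0Pr => e e0.
pose e' := e / (b - a + 1).
have ba1 : 0 < b - a + 1 by rewrite ltr_pwDr // subr_ge0.
have e'0 : 0 < e' by rewrite divr_gt0.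
suff H : g a <= g b + e' * (b - a).
  apply: le_trans H _; rewrite lerD2l /e' mulrAC ler_pdivrMr //.
  by rewrite ler_pM2l // lerDl.
have bab : a <= b <= b by rewrite ab lexx.
apply: (@real_induction a b (fun t => g a <= g t + e' * (t - a)) _ _ _ b bab).
- by rewrite subrr mulr0 addr0.
- move=> t /[dup] tab /andP[at_ tb] Pt; near=> s.
  have : - (e' * (s - t)) <= g s - g t by near: s; exact: gD.
  by lra.
- move=> t /andP[at_ tb] Pt; apply/ler_addgt0Pr => e1 e10.
  have gt : g s @[s --> t^'-] --> g t.
    by apply: cvg_at_left_filter; apply: gc; rewrite tb ltW.
  have [s [sP st as_]] : exists s, [/\ `|g t - g s| < e1, s < t & a <= s].
    near (t^'-) => s; exists s; split.
    + by near: s; move/cvgrPdist_lt : gt; apply.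
    + by [].
    + by near: s; exact: nbhs_left_ge.
  have := Pt s; rewrite as_ st => /(_ isT).
  move: sP; rewrite ltr_norml => /andP[s1 s2].
  have : e' * (s - a) <= e' * (t - a) by rewrite ler_pM2l // lerD2r ltW.
  by lra.
Unshelve. all: by end_near. Qed.

End Real_line.

Section Curves.
Context {R : realType} {n : nat}.
Implicit Types (c : 'rV[R]_n) (g p : R -> 'rV[R]_n) (L r rho s t : R).

(** For the velocity [p] of a curve [g] this is a nonsmooth form of
    [|p'(t)| <= L |p(t)|^2], which bounds the curvature of [g] at [t] by
    [L]. *)
Definition velocity_bound g p L t := forall e, 0 < e ->
  \forall s \near t,
    enorm (p s - p t) <= (L + e) * enorm (g s - g t) * enorm (p s).

(** As [g s] tends to [g t], the bound gives first [|p s| <= 2 |p t|], and then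
    [|p s - p t| <= 2 (L + 1) |g s - g t| |p t|]. *)
Lemma continuous_velocity g p L t : 0 <= L ->
  {for t, continuous g} -> velocity_bound g p L t -> {for t, continuous p}.
Proof.
move=> L0 gt pL.
have gd d : 0 < d -> \forall s \near t, enorm (g s - g t) < d.
  by move=> d0; exact: ((cvg_enormP _ _ _).2 gt).
apply/(cvg_enormP (nbhs_filter t)) => e e0.
have L1 : 0 < L + 1 by rewrite ltr_pwDr.
have c0 : 0 < (L + 1) * (2 * enorm (p t) + 1).
  by rewrite mulr_gt0 // ltr_pwDr // mulr_ge0 // enorm_ge0.
near=> s.
have h1 : enorm (p s - p t) <= (L + 1) * enorm (g s - g t) * enorm (p s).
  by near: s; exact: pL.
have h2 : enorm (g s - g t) < (2 * (L + 1))^-1.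
  by near: s; apply: gd; rewrite invr_gt0 mulr_gt0.
have h3 : enorm (g s - g t) < e / ((L + 1) * (2 * enorm (p t) + 1)).
  by near: s; apply: gd; rewrite divr_gt0.
have h4 : (L + 1) * enorm (g s - g t) <= 2^-1.
  by rewrite mulrC -ler_pdivlMr // -invfM ltW.
have ps0 := enorm_ge0 (p s); have pt0 := enorm_ge0 (p t).
have h5 : enorm (p s) <= 2 * enorm (p t).
  have h6 : (L + 1) * enorm (g s - g t) * enorm (p s) <= 2^-1 * enorm (p s).
    by rewrite ler_wpM2r.
  have := enormD (p s - p t) (p t); rewrite subrK; lra.
apply: le_lt_trans h1 _; move: h3; rewrite ltr_pdivlMr //; apply: le_lt_trans.
rewrite [in leRHS]mulrCA mulrA ler_wpM2l ?mulr_ge0 ?enorm_ge0 ?ltW //.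
by lra.
Unshelve. all: by end_near. Qed.

Variables (g p : R -> 'rV[R]_n) (c : 'rV[R]_n) (r L : R).
Hypothesis L_ge0 : 0 <= L.
Hypothesis rL_le1 : r * L <= 1.
Hypothesis g_p : forall t, 0 <= t <= 1 -> is_derive t 1 g (p t).
Hypothesis g_r : forall t, 0 <= t <= 1 -> enorm (g t - c) <= r.
Hypothesis g_L : forall t, 0 <= t <= 1 -> velocity_bound g p L t.

Let g_cont t : 0 <= t <= 1 -> {for t, continuous g}.
Proof.
by move=> /g_p dg; apply/differentiable_continuous/derivable1_diffP.
Qed.

Let p_cont t : 0 <= t <= 1 -> {for t, continuous p}.
Proof.
by move=> t01; apply: continuous_velocity (g_L t01) => //; exact: g_cont.
Qed.

Let slope t : 0 <= t <= 1 ->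
  (s - t)^-1 *: (g s - g t) @[s --> t^'] --> p t.
Proof.
move=> t01; have [dg pt] := g_p t01.
apply/cvg_enormP => e e0.
suff H : \forall s \near t, s != t ->
  enorm ((s - t)^-1 *: (g s - g t) - p t) < e by exact: H.
rewrite (near_shift 0 t) subr0.
move/cvg_enormP : dg => /(_ e e0); rewrite near_withinE.
apply: filterS => h /= H; rewrite addrK -subr_eq0 addrK => /H.
by rewrite [h *: 1]mulr1 -pt.
Qed.

Let dg := fun t => dot (g t - c) (p t).

Let dg_cont t : 0 <= t <= 1 -> {for t, continuous dg}.
Proof.
move=> t01; apply: (cvg_dot (nbhs_filter t)); last exact: p_cont.
by apply: cvgB; [exact: g_cont|exact: cvg_cst].
Qed.

Let sqr_dist_derive t : 0 <= t <= 1 ->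
  is_derive t 1 (fun t => dot (g t - c) (g t - c)) (2 * dg t).
Proof.
move=> t01; have [gt pt] := g_p t01.
have gt0 : g (h *: 1 + t) @[h --> 0^'] --> g t.
  apply: cvg_within_filter.
  have : h *: 1 + t @[h --> (0 : R)] --> (0 : R) *: 1 + t.
    by apply: cvgD; [apply: cvgZr_tmp; exact: cvg_id | exact: cvg_cst].
  rewrite scale0r add0r => ht.
  exact: (continuous_cvg _ (g_cont t01) ht).
have H : h^-1 *: (dot (g (h *: 1 + t) - c) (g (h *: 1 + t) - c)
                   - dot (g t - c) (g t - c)) @[h --> 0^'] --> 2 * dg t.
  have -> : 2 * dg t = dot (p t) (g t - c + (g t - c)).
    by rewrite /dg dotDr dotC; ring.
  have -> : (fun h : R => h^-1 *: (dot (g (h *: 1 + t) - c) (g (h *: 1 + t) - c)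
                   - dot (g t - c) (g t - c))) =
     (fun h => dot (h^-1 *: (g (h *: 1 + t) - g t))
                 (g (h *: 1 + t) - c + (g t - c))).
    apply/funext => h; rewrite dotZl; congr (_ * _).
    move: (g _) (g _) => x y; rewrite !dotE (dotC y x) (dotC c x) (dotC c y).
    by ring.
  apply: cvg_dot; first by rewrite -pt.
  by apply: cvgD; [apply: cvgB => //; exact: cvg_cst | exact: cvg_cst].
by apply: DeriveDef; [apply/cvg_ex; eexists; exact: H | exact: cvg_lim H].
Qed.

(** Half the second derivative of [|g - c|^2] is [|g'|^2 + <g - c, g''>], which
    is at least [(1 - r L) |g'|^2]. *)
Let dg_Dini t (e : R) : 0 <= t < 1 -> 0 < e ->
  \forall s \near t^'+, - (e * (s - t)) <= dg s - dg t.
Proof.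
move=> /andP[t0 t1] e0; have t01 : 0 <= t <= 1 by rewrite t0 ltW.
have r0 : 0 <= r by apply: le_trans (g_r t01); exact: enorm_ge0.
pose P2 := dot (p t) (p t).
have P20 : 0 <= P2 by exact: dot_ge0.
pose d := e / (r * P2 + 1).
have rP : 0 < r * P2 + 1 by rewrite ltr_pwDr // mulr_ge0.
have d0 : 0 < d by rewrite divr_gt0.
pose q s := (s - t)^-1 *: (g s - g t).
have qt : q s @[s --> t^'+] --> p t by apply: cvg_dnbhs_at_right; exact: slope.
have pt : p s @[s --> t^'+] --> p t.
  by apply: cvg_at_right_filter; exact: p_cont.
have H : dot (q s) (p s) - r * (L + d) * (enorm (q s) * enorm (p s))
    @[s --> t^'+] --> P2 - r * (L + d) * (enorm (p t) * enorm (p t)).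
  apply: cvgB; first exact: cvg_dot.
  apply: cvgM; first exact: cvg_cst.
  apply: cvgM.
    exact: (continuous_cvg _ (@enorm_continuous R n _) qt).
  exact: (continuous_cvg _ (@enorm_continuous R n _) pt).
have He : - e < P2 - r * (L + d) * (enorm (p t) * enorm (p t)).
  rewrite -expr2 sqr_enorm -/P2.
  have h1 : r * L * P2 <= P2 by rewrite ler_piMl.
  have h2 : r * d * P2 < e.
    have -> : r * d * P2 = e * (r * P2) / (r * P2 + 1) by rewrite /d; ring.
    by rewrite ltr_pdivrMr // ltr_pM2l // ltrDl.
  by rewrite mulrDr mulrDl; lra.
near=> s.
have ts : t < s by near: s; exact: nbhs_right_gt.
have st : 0 < s - t by rewrite subr_gt0.
have h1 : - e < dot (q s) (p s) - r * (L + d) * (enorm (q s) * enorm (p s)).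
  by near: s; move/cvgr_gt : H; apply.
have h2 : enorm (p s - p t) <= (L + d) * enorm (g s - g t) * enorm (p s).
  by near: s; apply: cvg_within; exact: g_L.
have gq : g s - g t = (s - t) *: q s.
  by rewrite scalerA divff ?scale1r // gt_eqF.
have -> : dg s - dg t = (s - t) * dot (q s) (p s) + dot (g t - c) (p s - p t).
  rewrite -dotZl -gq /dg !dotE; ring.
have := dot_geN (g t - c) (p s - p t).
have h3 : enorm (g t - c) * enorm (p s - p t) <=
    (s - t) * (r * (L + d) * (enorm (q s) * enorm (p s))).
  apply: le_trans (ler_pM (enorm_ge0 _) (enorm_ge0 _) (g_r t01) h2) _.
  rewrite gq enormZ gtr0_norm //.
  by rewrite le_eqVlt; apply/orP; left; apply/eqP; ring.
have h4 : (s - t) * - e <= (s - t) *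
   (dot (q s) (p s) - r * (L + d) * (enorm (q s) * enorm (p s))).
  by rewrite ler_pM2l // ltW.
by lra.
Unshelve. all: by end_near. Qed.

Let dg_mono s t : 0 <= s -> s <= t -> t <= 1 -> dg s <= dg t.
Proof.
move=> s0 st t1; apply: nondecreasing_of_Dini => // [u|u e] /andP[su ut].
  by apply: dg_cont; rewrite (le_trans s0 su) (le_trans ut t1).
by apply: dg_Dini; rewrite (le_trans s0 su) (lt_le_trans ut t1).
Qed.

(** The distance to [c] cannot first increase and then decrease, as the
    derivative of its square is nondecreasing. *)
Lemma curve_in_ball rho t : enorm (g 0 - c) <= rho -> enorm (g 1 - c) <= rho ->
  0 <= t <= 1 -> enorm (g t - c) <= rho.
Proof.
move=> g0 g1 /andP[t0 t1].
have rho0 : 0 <= rho by apply: le_trans g0; exact: enorm_ge0.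
have [->//|tn0] := eqVneq t 0; have [->//|tn1] := eqVneq t 1.
have {tn0}t0 : 0 < t by rewrite lt_def tn0.
have {tn1}t1 : t < 1 by rewrite lt_neqAle tn1.
rewrite leNgt; apply/negP => tr.
pose f s := dot (g s - c) (g s - c).
have ft : rho ^+ 2 < f t.
  by rewrite /f -sqr_enorm ltr_pXn2r // nnegrE // enorm_ge0.
have fc (a b : R) : 0 <= a -> b <= 1 -> {within `[a, b], continuous f}.
  move=> a0 b1; apply: derivable_within_continuous => u.
  rewrite in_itv /= => /andP[au ub].
  by have [] := @sqr_dist_derive u; rewrite ?(le_trans a0 au) ?(le_trans ub b1).
have fd (a b : R) : 0 <= a -> b <= 1 -> forall u : R, u \in `]a, b[ ->
    is_derive u 1 f (2 * dg u).
  move=> a0 b1 u; rewrite in_itv /= => /andP[au ub].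
  apply: sqr_dist_derive.
  by rewrite ?(le_trans a0 (ltW au)) ?(le_trans (ltW ub) b1).
have [u] := MVT t0 (fd 0 t (lexx _) (ltW t1)) (fc 0 t (lexx _) (ltW t1)).
rewrite in_itv /= => /andP[u0 ut] fu.
have [v] := MVT t1 (fd t 1 (ltW t0) (lexx _)) (fc t 1 (ltW t0) (lexx _)).
rewrite in_itv /= => /andP[tv v1] fv.
have := dg_mono (ltW u0) (ltW (lt_trans ut tv)) (ltW v1).
rewrite leNgt => /negP[].
have f0 : f 0 <= rho ^+ 2 by exact: dot_le_sqr.
have f1 : f 1 <= rho ^+ 2 by exact: dot_le_sqr.
apply: (@lt_trans _ _ 0).
  have : 2 * dg v * (1 - t) < 0 by rewrite -fv; lra.
  by rewrite pmulr_llt0 ?subr_gt0 // pmulr_rlt0.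
have : 0 < 2 * dg u * (t - 0) by rewrite -fu; lra.
by rewrite subr0 pmulr_lgt0 // pmulr_rgt0.
Qed.

End Curves.
(** * Jacobian matrices and local diffeomorphisms *)

Section Jacobian.
Context {R : realType} {n : nat}.
Implicit Types (f g : 'rV[R]_n -> 'rV[R]_n) (x y z v w : 'rV[R]_n).
Implicit Types (X : set 'rV[R]_n) (a b e L : R).

Lemma diff_jacobian f x v : 'd f x v = v *m jacobian f x.
Proof. by rewrite /jacobian mul_rV_lin1. Qed.

Lemma eq_mulmxr (A B : 'M[R]_n) : (forall v, v *m A = v *m B) -> A = B.
Proof. by move=> AB; apply/row_matrixP => i; rewrite !rowE AB. Qed.

Lemma jacobian_comp f g x : differentiable f x -> differentiable g (f x) ->
  jacobian (g \o f) x = jacobian f x *m jacobian g (f x).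
Proof.
move=> df dg; apply: eq_mulmxr => v.
by rewrite -diff_jacobian diff_comp // mulmxA -!diff_jacobian.
Qed.

Lemma jacobian_id x : jacobian id x = 1%:M.
Proof.
apply: eq_mulmxr => v; rewrite -diff_jacobian mulmx1.
by rewrite (@diff_val _ _ _ _ _ _ _ (is_diff_id x)).
Qed.

Lemma jacobian_cancel f g x : differentiable f x -> differentiable g (f x) ->
  (\forall y \near x, g (f y) = y) ->
  jacobian f x *m jacobian g (f x) = 1%:M.
Proof.
move=> df dg gf; rewrite -jacobian_comp //.
have dgf := differentiable_comp df dg; have [did idE] := is_diff_id x.
apply: eq_mulmxr => v; transitivity ('d (g \o f) x v).
  by rewrite diff_jacobian.
by rewrite -deriveE // (near_eq_derive v gf) deriveE // idE mulmx1.
Qed.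

Lemma near_jacobian f x e : differentiable f x -> 0 < e ->
  \forall y \near x,
    enorm (f y - f x - (y - x) *m jacobian f x) <= e * enorm (y - x).
Proof.
move=> df e0; rewrite (near_shift 0 x) subr0.
have e'0 : 0 < e / n.+1%:R by rewrite divr_gt0.
have /eqaddoP/(_ _ e'0) := diff_locally df; apply: filterS => h /= H.
rewrite addrK -diff_jacobian.
apply: le_trans (enorm_le_norm _) _.
rewrite -addrA -opprD.
apply: (@le_trans _ _ (n.+1%:R * (e / n.+1%:R * `|h|))).
  by apply: ler_pM => //; rewrite ler_nat.
by rewrite mulrA mulrCA divff ?mulr1 ?pnatr_eq0 // ler_pM2l // norm_le_enorm.
Qed.

(** The map [y |-> f'(x)^-1 f'(y)] has the Lipschitz constant [L] at the point
    [x], up to an arbitrarily small error. *)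
Definition jacobian_lip f L x := forall e, 0 < e -> \forall y \near x,
  forall v, enorm (v *m (jacobian f y *m invmx (jacobian f x)) - v)
              <= (L + e) * enorm (y - x) * enorm v.

Lemma jacobian_lip_le f L L' x : L <= L' ->
  jacobian_lip f L x -> jacobian_lip f L' x.
Proof.
move=> LL' fL e /fL; apply: filterS => y fy v; apply: le_trans (fy v) _.
by rewrite ler_wpM2r ?enorm_ge0 // ler_wpM2r ?enorm_ge0 // lerD2r.
Qed.

Lemma jacobian_lip_limsup f L x : jacobian f x \in unitmx ->
  ((limf_esup (fun h => (opnorm (jacobian f (x + h) *m invmx (jacobian f x)
      - 1%:M) / enorm h)%:E) (0 : 'rV[R]_n)^')%R <= L%:E)%E ->
  jacobian_lip f L x.
Proof.
move=> ux Lf e e0.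
have : ((limf_esup (fun h => (opnorm (jacobian f (x + h) *m invmx (jacobian f x)
      - 1%:M) / enorm h)%:E) (0 : 'rV[R]_n)^')%R < (L + e)%:E)%E.
  by apply: le_lt_trans Lf _; rewrite lte_fin ltrDl.
rewrite limf_esupE => /ereal_inf_lt[_ [A A0 <-] supA].
suff H : \forall h \near (0 : 'rV[R]_n), forall v,
    enorm (v *m (jacobian f (h + x) *m invmx (jacobian f x)) - v)
      <= (L + e) * enorm h * enorm v.
  rewrite (near_shift 0 x) subr0; apply: filterS H => h H v /=.
  by rewrite addrK.
have : \forall h \near (0 : 'rV[R]_n), h != 0 -> A h by exact: A0.
apply: filterS => h hA v; rewrite (addrC h x).
have [->|h0] := eqVneq h 0.
  by rewrite addr0 mulmxV // mulmx1 subrr enorm0 mulr0 mul0r.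
have hp : 0 < enorm h.
  by rewrite lt_def enorm_ge0 andbT; apply: contra h0 => /eqP/enorm_eq0 ->.
rewrite -[X in _ - X]mulmx1 -mulmxBr; apply: le_trans (le_opnorm _ _) _.
rewrite ler_wpM2r ?enorm_ge0 // -ler_pdivrMr // -lee_fin; apply: ltW.
by apply: le_lt_trans supA; apply: ereal_sup_ubound; exists h => //; exact: hA.
Qed.

(** This is the identity
    [Q B A^-1 P^-1 - 1 = (Q P^-1 - 1) + Q (B A^-1 - 1) P^-1]. *)
Lemma relative_change_mulmx (P Q A B : 'M[R]_n) a b al be :
  P \in unitmx -> A \in unitmx -> 0 <= a -> 0 < b -> 0 <= be ->
  (forall v, enorm (v *m P) <= a * enorm v) ->
  (forall v, b * enorm v <= enorm (v *m P)) ->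
  (forall v, enorm (v *m (Q *m invmx P) - v) <= al * enorm v) ->
  (forall v, enorm (v *m (B *m invmx A) - v) <= be * enorm v) ->
  forall v, enorm (v *m (Q *m B *m invmx (P *m A)) - v)
              <= (al + b^-1 * be * (a * (1 + al))) * enorm v.
Proof.
move=> uP uA a0 b0 be0 aP bP alQ beB v.
have uPA : P *m A \in unitmx by rewrite unitmx_mul uP.
have -> : v *m (Q *m B *m invmx (P *m A)) - v =
    (v *m (Q *m invmx P) - v) +
    ((v *m Q) *m (B *m invmx A) - v *m Q) *m invmx P.
  have -> : invmx (P *m A) = invmx A *m invmx P.
    apply: (can_inj (mulKmx uPA)); rewrite mulmxV // -mulmxA mulKVmx //.
    by rewrite mulmxV.
  by rewrite mulmxBl !mulmxA [RHS]addrC addrA subrK.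
have Q1 : enorm (v *m Q) <= a * (1 + al) * enorm v.
  have -> : v *m Q = (v *m (Q *m invmx P) - v + v) *m P.
    by rewrite subrK mulmxA mulmxKV.
  apply: le_trans (aP _) _; rewrite -mulrA ler_wpM2l //.
  apply: le_trans (enormD _ _) _; rewrite mulrDl mul1r addrC lerD2l.
  exact: alQ.
have P1 w : enorm (w *m invmx P) <= b^-1 * enorm w.
  by rewrite ler_pdivlMl // -{2}[w](mulmxKV uP) bP.
apply: le_trans (enormD _ _) _; rewrite mulrDl lerD //.
apply: le_trans (P1 _) _; rewrite -!mulrA ler_pM2l ?invr_gt0 //.
by apply: le_trans (beB _) _; rewrite ler_wpM2l // mulrA.
Qed.

(** To first order in [d := |y - x|], the relative change of [f'] at [y] is at
    most [L d], and that of [g'] at [f y] is at most [L' |f'(x)| d]. *)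
Lemma jacobian_lip_comp f g x c L L' :
  (\forall y \near x, differentiable f y) ->
  (\forall z \near f x, differentiable g z) ->
  jacobian f x \in unitmx -> jacobian g (f x) \in unitmx ->
  distortion_le (jacobian f x) c -> 0 <= L -> 0 <= L' ->
  jacobian_lip f L x -> jacobian_lip g L' (f x) ->
  jacobian_lip (g \o f) (L + L' * c) x.
Proof.
move=> df dg uP uA [a [b [a0 b0 ab aP bP]]] L0 L'0 fL gL'.
apply: (@jacobian_lip_le _ (L + L' * (a ^+ 2 / b))).
  by rewrite lerD2l ler_wpM2l.
move=> e e0.
have dfx : differentiable f x by exact: nbhs_singleton df.
have fcont : {for x, continuous f} by exact: differentiable_continuous.
(* The estimate obtained with tolerance [d] tends to the claimed one. *)
have [d d0 dP] : exists2 d : R, 0 < d &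
    L + d + b^-1 * ((L' + d) * (a + d)) * (a * (1 + d))
      <= L + L' * (a ^+ 2 / b) + e.
  pose F d := L + d + b^-1 * ((L' + d) * (a + d)) * (a * (1 + d)).
  have Fc : F d @[d --> (0 : R)] --> F 0.
    apply: cvgD; first by apply: cvgD; [exact: cvg_cst|exact: cvg_id].
    apply: cvgM.
      apply: cvgM; first exact: cvg_cst.
      by apply: cvgM; (apply: cvgD; [exact: cvg_cst|exact: cvg_id]).
    apply: cvgM; first exact: cvg_cst.
    by apply: cvgD; [exact: cvg_cst|exact: cvg_id].
  have F0 : F 0 = L + L' * (a ^+ 2 / b) by rewrite /F; ring.
  near ((0 : R)^'+) => d; exists d => //.
  rewrite -F0 -lerBlDl; apply: ltW; apply: le_lt_trans (ler_norm _) _.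
  rewrite distrC; near: d; apply: cvg_within.
  by move/cvgrPdist_lt : Fc; apply.
have Ld : 0 < L + d by rewrite ltr_wpDl.
near=> y => v.
have -> : jacobian (g \o f) x = jacobian f x *m jacobian g (f x).
  by apply: jacobian_comp => //; exact: nbhs_singleton dg.
have -> : jacobian (g \o f) y = jacobian f y *m jacobian g (f y).
  apply: jacobian_comp; first by near: y.
  by near: y; exact: (fcont _ dg).
have y1 w : enorm (w *m (jacobian f y *m invmx (jacobian f x)) - w)
    <= (L + d) * enorm (y - x) * enorm w.
  by move: w; near: y; exact: (fL _ d0).
have y2 w : enorm (w *m (jacobian g (f y) *m invmx (jacobian g (f x))) - w)
    <= (L' + d) * enorm (f y - f x) * enorm w.
  by move: w; near: y; exact: (fcont _ (gL' _ d0)).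
have y3 : enorm (f y - f x) <= (a + d) * enorm (y - x).
  have h : enorm (f y - f x - (y - x) *m jacobian f x) <= d * enorm (y - x).
    by near: y; exact: near_jacobian.
  have := enormD (f y - f x - (y - x) *m jacobian f x)
    ((y - x) *m jacobian f x).
  by rewrite subrK => h'; have := aP (y - x); lra.
have y4 : (L + d) * enorm (y - x) <= d.
  rewrite mulrC -ler_pdivlMr // ltW //; near: y; apply: near_enorm_lt.
  exact: divr_gt0.
have fe0 : 0 <= (L' + d) * enorm (f y - f x).
  by rewrite mulr_ge0 ?enorm_ge0 // addr_ge0 // ltW.
apply: le_trans (relative_change_mulmx uP uA a0 b0 fe0 aP bP y1 y2 v) _.
rewrite ler_wpM2r ?enorm_ge0 //.
apply: (@le_trans _ _ ((L + d) * enorm (y - x) +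
    b^-1 * ((L' + d) * ((a + d) * enorm (y - x))) * (a * (1 + d)))).
  rewrite lerD2l; apply: ler_pM => //; last by rewrite ler_wpM2l // lerD2l.
  - by rewrite mulr_ge0 // invr_ge0 ltW.
  - by rewrite mulr_ge0 // addr_ge0 // mulr_ge0 ?enorm_ge0 // ltW.
  - by rewrite ler_pM2l ?invr_gt0 // ler_wpM2l // addr_ge0 // ltW.
have -> : (L + d) * enorm (y - x) +
    b^-1 * ((L' + d) * ((a + d) * enorm (y - x))) * (a * (1 + d)) =
    (L + d + b^-1 * ((L' + d) * (a + d)) * (a * (1 + d))) * enorm (y - x).
  by ring.
by rewrite ler_wpM2r ?enorm_ge0.
Unshelve. all: by end_near. Qed.

End Jacobian.
Section Local_inverse.
Context {R : realType} {n : nat}.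
Implicit Types (f g : 'rV[R]_n -> 'rV[R]_n) (x y z v : 'rV[R]_n).
Implicit Types (X Y : set 'rV[R]_n).

(** The last clause says that [f @` X] is open and that [g] maps it to [X]. *)
Definition local_inverse X f g := forall x, X x ->
  [/\ X (f x), differentiable f x, differentiable g (f x), g (f x) = x &
      \forall z \near f x, X (g z) /\ f (g z) = z].

Lemma C1_diffeo_local_inverse X Y f : open Y -> Y `<=` X -> C1_diffeo X Y f ->
  exists g, local_inverse X f g.
Proof.
move=> Yo YX [[fXY _ fs] fC [g gf gC]]; exists g => x Xx.
have Yfx : Y (f x) by exact: fXY.
split; [exact: YX|by have [] := fC x Xx|by have [] := gC _ Yfx| |].
  by apply: gf; rewrite inE.
apply: filterS (open_nbhs_nbhs (conj Yo Yfx)) => z /fs[y Xy <-].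
by rewrite gf // inE.
Qed.

Lemma local_inverse_id X : open X -> local_inverse X id id.
Proof.
move=> Xo x Xx; split => //.
by apply: filterS (open_nbhs_nbhs (conj Xo Xx)) => z.
Qed.

Lemma local_inverse_comp X f1 f2 g1 g2 : local_inverse X f1 g1 ->
  local_inverse X f2 g2 -> local_inverse X (f2 \o f1) (g1 \o g2).
Proof.
move=> i1 i2 x Xx; have [X1 d1 e1 c1 n1] := i1 x Xx.
have [X2 d2 e2 c2 n2] := i2 _ X1.
split => //=; [exact: differentiable_comp| |by rewrite c2|].
  by apply: differentiable_comp => //; rewrite c2.
have g2c : g2 z @[z --> f2 (f1 x)] --> f1 x.
  by rewrite -[X in _ --> X]c2; exact: differentiable_continuous.
have {}n1 : \forall z \near f2 (f1 x), X (g1 (g2 z)) /\ f1 (g1 (g2 z)) = g2 z.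
  exact: (g2c _ n1).
near=> z; have [] : X (g1 (g2 z)) /\ f1 (g1 (g2 z)) = g2 z by near: z.
move=> Xz ->; split => //.
by have [] : X (g2 z) /\ f2 (g2 z) = z by near: z.
Unshelve. all: by end_near. Qed.

Variables (X : set 'rV[R]_n) (f g : 'rV[R]_n -> 'rV[R]_n).
Hypotheses (X_open : open X) (fg : local_inverse X f g).

Lemma jacobian_local_inverse x : X x ->
  jacobian f x *m jacobian g (f x) = 1%:M.
Proof.
move=> Xx; have [_ df dg _ _] := fg Xx; apply: jacobian_cancel => //.
by apply: filterS (open_nbhs_nbhs (conj X_open Xx)) => y /fg[].
Qed.

Let mulmx1_invmx (A B : 'M[R]_n) : A *m B = 1%:M ->
  A \in unitmx /\ B = invmx A.
Proof.
move=> AB; have [uA _] := mulmx1_unit AB; split => //.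
by rewrite -(mulKmx uA B) AB mulmx1.
Qed.

Lemma jacobian_unit x : X x -> jacobian f x \in unitmx.
Proof.
by move=> Xx; have E := jacobian_local_inverse Xx; have [] := mulmx1_invmx E.
Qed.

Lemma jacobian_inverse x : X x -> jacobian g (f x) = invmx (jacobian f x).
Proof.
by move=> Xx; have E := jacobian_local_inverse Xx; have [] := mulmx1_invmx E.
Qed.

End Local_inverse.

(** * Images of intersections of balls *)

Section Ball_intersections.
Context {R : realType} {n : nat}.
Implicit Types (x y z c u v : 'rV[R]_n) (r rho s t : R).

Definition ball_cap (M : set 'rV[R]_n) r : set 'rV[R]_n :=
  \bigcap_(c in M) [set y | enorm (y - c) <= r].

Lemma sqr_dist_segment x y c t :
  enorm (x + t *: (y - x) - c) ^+ 2 =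
  (1 - t) * enorm (x - c) ^+ 2 + t * enorm (y - c) ^+ 2
    - t * (1 - t) * enorm (y - x) ^+ 2.
Proof.
have -> : x + t *: (y - x) - c = x - c + t *: (y - c - (x - c)).
  by rewrite opprB addrA subrK addrAC.
have -> : y - x = y - c - (x - c) by rewrite opprB addrA subrK.
move: (x - c) (y - c) => {}x {}y.
by rewrite !sqr_enorm !dotE (dotC y x); ring.
Qed.

Lemma segment_ball_cap M r x y t : ball_cap M r x -> ball_cap M r y ->
  0 <= t <= 1 -> ball_cap M r (x + t *: (y - x)).
Proof.
move=> Mx My /andP[t0 t1] c Mc /=.
have xc := Mx c Mc; have yc := My c Mc; rewrite /= in xc yc.
apply: enorm_le; first by apply: le_trans xc; exact: enorm_ge0.
rewrite -sqr_enorm sqr_dist_segment.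
have := dot_le_sqr xc; have := dot_le_sqr yc; rewrite -!sqr_enorm => yc2 xc2.
have h1 : (1 - t) * enorm (x - c) ^+ 2 <= (1 - t) * r ^+ 2.
  by rewrite ler_wpM2l // subr_ge0.
have h2 : t * enorm (y - c) ^+ 2 <= t * r ^+ 2 by rewrite ler_wpM2l.
have h3 : 0 <= t * (1 - t) * enorm (y - x) ^+ 2.
  by rewrite !mulr_ge0 ?subr_ge0 ?enorm_ge0.
by lra.
Qed.

(** Balls of one radius are uniformly strictly convex, so the inner points of
    a segment keep a common distance from all the bounding spheres. *)
Lemma segment_ball_cap_lt M r x y : M !=set0 -> x != y ->
  ball_cap M r x -> ball_cap M r y -> forall t, 0 < t < 1 ->
  exists2 rho, rho < r &
    ball_cap M rho (x + t *: (y - x)) /\ ball_cap M rho (y + t *: (x - y)).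
Proof.
move=> [c0 Mc0] xy Mx My t /andP[t0 t1].
have r0 : 0 <= r by apply: le_trans (Mx _ Mc0); exact: enorm_ge0.
have dp : 0 < t * (1 - t) * enorm (y - x) ^+ 2.
  rewrite mulr_gt0 ?exprn_gt0 ?mulr_gt0 ?subr_gt0 // lt_def enorm_ge0 andbT.
  by apply: contra xy => /eqP/enorm_eq0/eqP; rewrite subr_eq0 eq_sym.
pose q := r ^+ 2 - t * (1 - t) * enorm (y - x) ^+ 2.
have H a b : enorm (b - a) = enorm (y - x) ->
    ball_cap M r a -> ball_cap M r b ->
    forall c, M c -> enorm (a + t *: (b - a) - c) ^+ 2 <= q.
  move=> ab Ma Mb c Mc; rewrite sqr_dist_segment ab.
  have := dot_le_sqr (Ma c Mc); have := dot_le_sqr (Mb c Mc).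
  rewrite -!sqr_enorm => yc2 xc2.
  have h1 : (1 - t) * enorm (a - c) ^+ 2 <= (1 - t) * r ^+ 2.
    by rewrite ler_wpM2l // subr_ge0 ltW.
  have h2 : t * enorm (b - c) ^+ 2 <= t * r ^+ 2 by rewrite ler_wpM2l // ltW.
  by rewrite /q; lra.
have q0 : 0 <= q by apply: le_trans (H x y erefl Mx My _ Mc0); exact: sqr_ge0.
exists (Num.sqrt q).
  rewrite -ltr_sqr ?nnegrE ?sqrtr_ge0 // sqr_sqrtr //.
  by rewrite /q gtrBl.
by split => c Mc /=; apply: enorm_le; rewrite ?sqrtr_ge0 // sqr_sqrtr //
  -sqr_enorm; apply: H => //; exact: enormBC.
Qed.

Lemma near_ball_cap M r rho x : rho < r -> ball_cap M rho x ->
  \forall y \near x, ball_cap M r y.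
Proof.
move=> rr Mx; near=> y => c Mc /=.
have yx : enorm (y - x) < r - rho.
  by near: y; apply: near_enorm_lt; rewrite subr_gt0.
have := Mx c Mc; rewrite /= => xc.
by have := enormD (y - x) (x - c); rewrite addrA subrK; lra.
Unshelve. all: by end_near. Qed.

Lemma compact_ball_cap M r : M !=set0 -> compact (ball_cap M r).
Proof.
move=> [c0 Mc0]; apply: bounded_closed_compact.
  exists (r + enorm c0); split; first exact: num_real.
  move=> m m1 y /(_ c0 Mc0) /= yc; apply: le_trans (norm_le_enorm _) _.
  by have := enormD (y - c0) c0; rewrite subrK; lra.
apply: closed_bigI => c Mc.
have -> : [set y | enorm (y - c) <= r] =
  (fun y => enorm (y - c)) @^-1` [set t | t <= r] by [].
apply: preimage_closed; last exact: closed_le.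
move=> y _.
apply: (continuous_cvg (nbhs_filter y) (@enorm_continuous R n (y - c))).
apply: (@cvgB _ _ _ (nbhs y) (nbhs_filter y)); first exact: cvg_id.
exact: (@cvg_cst _ c _ (nbhs y) (nbhs_filter y)).
Qed.

Section Image.
Variables (X M : set 'rV[R]_n) (f g : 'rV[R]_n -> 'rV[R]_n) (r L : R).
Hypotheses (X_open : open X) (fg : local_inverse X f g).
Hypotheses (M_neq0 : M !=set0) (MX : ball_cap M r `<=` X).
Hypotheses (L_ge0 : 0 <= L) (rL_le1 : r * L <= 1).
Hypothesis f_lip : forall x, ball_cap M r x -> jacobian_lip f L x.

Let fX x : X x -> {for x, continuous f}.
Proof. by move=> /fg[_ df _ _ _]; exact: differentiable_continuous. Qed.

Let closed_image rho : rho <= r -> closed (f @` ball_cap M rho).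
Proof.
move=> rr; apply: compact_closed; first exact: norm_hausdorff.
apply: continuous_compact; last exact: compact_ball_cap.
apply: continuous_in_subspaceT => x; rewrite inE => Mx; apply: fX; apply: MX.
by move=> c Mc; exact: le_trans (Mx c Mc) rr.
Qed.

(** The inverse image of a segment is a curve [q] with [q' = v f'(q)^-1].
    The estimate for [f] bounds its curvature by [L <= 1 / r], so that the
    curve lies in every ball around a center in [M] which contains its
    endpoints, as long as its distance to the center is at most [r]. *)
Lemma segment_image_ball_cap rho z v :
  (forall t, 0 <= t <= 1 -> (f @` ball_cap M r) (z + t *: v)) ->
  (f @` ball_cap M rho) z -> (f @` ball_cap M rho) (z + v) -> rho <= r ->
  forall t, 0 <= t <= 1 -> (f @` ball_cap M rho) (z + t *: v).
Proof.
move=> zv z0 z1 rr.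
pose q t := g (z + t *: v).
have fq t : 0 <= t <= 1 -> f (q t) = z + t *: v /\ ball_cap M r (q t).
  move=> /zv [x Mx xt]; have [_ _ _ gx _] := fg (MX Mx).
  by rewrite /q -xt gx.
have gin y : (f @` ball_cap M rho) y -> ball_cap M rho (g y).
  move=> [x Mx <-]; have [|_ _ _ -> //] := @fg x.
  by apply: MX => c Mc; exact: le_trans (Mx c Mc) rr.
have q0 : ball_cap M rho (q 0) by apply: gin; rewrite scale0r addr0.
have q1 : ball_cap M rho (q 1) by apply: gin; rewrite scale1r.
pose p t := v *m invmx (jacobian f (q t)).
have line_diff t : is_diff t (fun t => z + t *: v) (fun t => t *: v).
  have -> : (fun t : R => t *: v) = 0 + (fun t => t *: v).
    by apply/funext => s; rewrite fctE add0r.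
  exact: is_diffD.
have dq t : 0 <= t <= 1 -> is_derive t 1 q (p t).
  move=> t01; have [fqt Mt] := fq t t01.
  have [_ _ + _ _] := fg (MX Mt); rewrite fqt => dg.
  have dl : differentiable (fun t => z + t *: v) t by [].
  have dqt : differentiable q t by exact: differentiable_comp.
  apply: DeriveDef; first exact: diff_derivable.
  rewrite deriveE // diff_comp //= diff_val scale1r diff_jacobian.
  by rewrite -fqt (jacobian_inverse X_open fg) //; exact: MX.
have qL t : 0 <= t <= 1 -> velocity_bound q p L t.
  move=> t01 e e0; have [fqt Mt] := fq t t01.
  have qc : {for t, continuous q}.
    have dqt := dq t t01.
    exact/differentiable_continuous/derivable1_diffP.
  have Xn : \forall s \near t, X (q s).
    by apply: qc; exact: open_nbhs_nbhs (conj X_open (MX Mt)).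
  have qn : \forall s \near t, forall w,
      enorm (w *m (jacobian f (q s) *m invmx (jacobian f (q t))) - w)
      <= (L + e) * enorm (q s - q t) * enorm w := qc _ (f_lip Mt e0).
  near=> s; rewrite enormBC.
  have Xs : X (q s) by near: s.
  have -> : p t = p s *m (jacobian f (q s) *m invmx (jacobian f (q t))).
    by rewrite mulmxA mulmxKV // (jacobian_unit X_open fg).
  suff : forall w,
      enorm (w *m (jacobian f (q s) *m invmx (jacobian f (q t))) - w)
        <= (L + e) * enorm (q s - q t) * enorm w by exact.
  by near: s.
move=> t t01; have [fqt Mt] := fq t t01; exists (q t) => // c Mc /=.
apply: (curve_in_ball L_ge0 rL_le1 dq) => //.
- by move=> s s01; have [_] := fq s s01; exact.
- exact: q0.
- exact: q1.
Unshelve. all: by end_near. Qed.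

(** The segments from [f x] to [f (x + s (y - x))] are followed from [s = 0]
    to [s = 1]. Being contained in the image of the smaller set is a closed
    condition on [s]. It is also open: nearby segments are contained in the
    image of the larger set, hence in that of the smaller one by
    [segment_image_ball_cap]. *)
Lemma segment_image_inner rho x y : rho < r ->
  ball_cap M rho x -> ball_cap M rho y ->
  forall t, 0 <= t <= 1 -> (f @` ball_cap M rho) (f x + t *: (f y - f x)).
Proof.
move=> rr Mx My.
have Mr u : ball_cap M rho u -> ball_cap M r u.
  by move=> Mu c Mc; apply: le_trans (Mu c Mc) (ltW rr).
pose xs s : 'rV[R]_n := x + s *: (y - x).
have xsM s : 0 <= s <= 1 -> ball_cap M rho (xs s).
  exact: segment_ball_cap.
have xsc s : 0 <= s <= 1 -> f (xs s') @[s' --> s] --> f (xs s).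
  move=> s01; have xc : xs s' @[s' --> s] --> xs s.
    by apply: cvgD; [exact: cvg_cst|apply: cvgZr_tmp; exact: cvg_id].
  exact: (continuous_cvg (nbhs_filter s) (fX (MX (Mr _ (xsM s s01)))) xc).
suff H s : 0 <= s <= 1 -> forall t, 0 <= t <= 1 ->
    (f @` ball_cap M rho) (f x + t *: (f (xs s) - f x)).
  have := H 1; rewrite /xs scale1r [x + _]addrC subrK.
  by apply; rewrite ler01 lexx.
apply: (real_induction (P := fun s => forall t, 0 <= t <= 1 ->
    (f @` ball_cap M rho) (f x + t *: (f (xs s) - f x)))).
- by move=> t _; rewrite /xs scale0r addr0 subrr scaler0 addr0; exists x.
- move=> {}s /andP[s0 s1] Ps.
  have s01 : 0 <= s <= 1 by rewrite s0 ltW.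
  have tube : \forall s' \near s, `[0, 1] `<=`
      (fun t => (f @` ball_cap M r) (f x + t *: (f (xs s') - f x))).
    have /compact_near_coveringP cov := @segment_compact R 0 1.
    apply: (cov _ (nbhs s) (fun s' t =>
      (f @` ball_cap M r) (f x + t *: (f (xs s') - f x)))).
    move=> t /=; rewrite in_itv /= => t01.
    have [u Mu fu] := Ps t t01.
    have [_ _ dg gu nu] := fg (MX (Mr _ Mu)).
    have gc : {for f u, continuous g} by exact: differentiable_continuous.
    have imn : \forall z \near f u, (f @` ball_cap M r) z.
      have gM : \forall z \near f u, ball_cap M r (g z).
        by apply: gc; rewrite gu; exact: near_ball_cap Mu.
      near=> z; exists (g z); first by near: z.
      by have [] : X (g z) /\ f (g z) = z by near: z.
    have : f x + z.1 *: (f (xs z.2) - f x) @[z --> (t, s)] --> f u.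
      rewrite fu; apply: cvgD; first exact: cvg_cst.
      apply: cvgZ; first exact: cvg_fst.
      apply: cvgB; last exact: cvg_cst.
      by apply: (cvg_comp _ _ _ (xsc s s01)); exact: cvg_snd.
    by move=> /(_ _ imn).
  near=> s'.
  have ss : s < s' by near: s'; exact: nbhs_right_gt.
  have s'1 : s' <= 1 by apply: ltW; near: s'; exact: nbhs_right_lt.
  have s'01 : 0 <= s' <= 1 by rewrite s'1 (le_trans s0) ?(ltW ss).
  apply: segment_image_ball_cap; last exact: ltW.
  + move=> t t01.
    suff : `[0, 1] `<=`
      (fun t => (f @` ball_cap M r) (f x + t *: (f (xs s') - f x))).
      by apply; rewrite /= in_itv.
    by near: s'; exact: cvg_within tube.
  + by exists x.
  + by rewrite addrC subrK; exists (xs s') => //; exact: xsM.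
- move=> {}s /andP[s0 s1] Ps t t01; have s01 : 0 <= s <= 1 by rewrite s1 ltW.
  apply: (@closed_cvg _ _ (s^'-) _
    (fun s' => f x + t *: (f (xs s') - f x)) _ (closed_image (ltW rr))).
    near=> s'; apply: Ps => //; apply/andP; split; last by [].
    by near: s'; exact: nbhs_left_ge.
  apply: cvgD; first exact: cvg_cst.
  apply: cvgZl_tmp; apply: cvgB; last exact: cvg_cst.
  by apply: cvg_at_left_filter; exact: xsc.
Unshelve. all: by end_near. Qed.

(** The inner points of the segment from [x] to [y] fall under
    [segment_image_inner], and the image is closed. *)
Lemma segment_image x y t : ball_cap M r x -> ball_cap M r y ->
  0 <= t <= 1 -> (f @` ball_cap M r) (f x + t *: (f y - f x)).
Proof.
move=> Mx My t01; have [->|xy] := eqVneq x y.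
  by rewrite subrr scaler0 addr0; exists y.
have fc a b : X a -> f (a + d *: (b - a)) @[d --> 0^'+] --> f a.
  move=> Xa; apply: cvg_at_right_filter.
  have ac : a + d *: (b - a) @[d --> (0 : R)] --> a.
    rewrite -[X in _ --> X]addr0 -(scale0r (b - a)).
    by apply: cvgD; [exact: cvg_cst|apply: cvgZr_tmp; exact: cvg_id].
  exact: (continuous_cvg (nbhs_filter (0 : R)) (fX Xa) ac).
apply: (@closed_cvg _ _ ((0 : R)^'+) _
   (fun d => f (x + d *: (y - x)) +
             t *: (f (y + d *: (x - y)) - f (x + d *: (y - x)))) _
   (closed_image (lexx r))).
  near=> d; have d01 : 0 < d < 1.
    apply/andP; split; near: d; first exact: nbhs_right_gt.
    exact: nbhs_right_lt.
  have [rho rr [Mxd Myd]] := segment_ball_cap_lt M_neq0 xy Mx My d01.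
  have [u Mu fu] := segment_image_inner rr Mxd Myd t01.
  by exists u => // c Mc; apply: le_trans (Mu c Mc) (ltW rr).
apply: cvgD; first by apply: fc; exact: MX.
by apply: cvgZl_tmp; apply: cvgB; apply: fc; exact: MX.
Unshelve. all: by end_near. Qed.

End Image.
End Ball_intersections.
(** * Iterated maps *)

Section Iteration.
Context {R : realType} {n : nat} {U : Type}.
Variables (X : set 'rV[R]_n) (G : 'rV[R]_n -> U -> 'rV[R]_n).
Hypotheses (n_gt0 : (0 < n)%N) (X_open : open X).
Hypothesis G_inverse : forall w, exists g, local_inverse X (G^~ w) g.

Lemma psi_local_inverse k u :
  exists g, local_inverse X (fun x => psi G k x u) g.
Proof.
elim: k => [|k [g kg]]; first by exists id; exact: local_inverse_id.
have [h Gh] := G_inverse (u k).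
by exists (g \o h); exact: local_inverse_comp kg Gh.
Qed.

Variables (N : nat) (Omega : set 'rV[R]_n) (L1 L2 : R).
Hypotheses (Omega_X : Omega `<=` X) (L2_ge0 : 0 <= L2).
Hypothesis L1_bound : forall x w, psi_before G N Omega x ->
  alpha_max (jacobian (G^~ w) x) ^+ 2 / alpha_min (jacobian (G^~ w) x) <= L1.
Hypothesis L2_lip : forall x w, psi_before G N Omega x ->
  jacobian_lip (G^~ w) L2 x.

(** One more step adds to the constant the one of [G], which is transported
    to the initial point by the Jacobian matrix [P] of [psi G k]. The price is
    the factor [|P|^2 |P^-1|], at most [L1 ^+ k] by the product of the bounds
    for the single steps. *)
Lemma psi_jacobian_lip k u x : (k <= N)%N -> Omega x ->
  jacobian_lip (fun x => psi G k x u) (L2 * \sum_(i < k) L1 ^+ i) x.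
Proof.
move=> kN Ox.
suff [] : jacobian_lip (fun x => psi G k x u) (L2 * \sum_(i < k) L1 ^+ i) x /\
    distortion_le (jacobian (fun x => psi G k x u) x) (L1 ^+ k) by [].
elim: k kN => [_|k IH kN].
  have -> : jacobian (fun x => psi G 0 x u) x = 1%:M by exact: jacobian_id.
  split; last exact: distortion1.
  move=> e e0; near=> y => v.
  have J1 z : jacobian (fun x => psi G 0 x u) z = 1%:M by exact: jacobian_id.
  rewrite !J1 mul1mx invmx1 mulmx1 subrr enorm0 big_ord0 mulr0 add0r.
  by rewrite !mulr_ge0 ?enorm_ge0 // ltW.
have [kL kD] := IH (ltnW kN).
have By : psi_before G N Omega (psi G k x u) by exists k, x, u.
have [g kg] := psi_local_inverse k u; have [h Gh] := G_inverse (u k).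
have Xx := Omega_X Ox; have [Xk dk _ _ _] := kg _ Xx.
have [_ dG _ _ _] := Gh _ Xk.
have nX z : X z -> \forall y \near z, X y.
  by move=> Xz; exact: open_nbhs_nbhs (conj X_open Xz).
have uP := jacobian_unit X_open kg Xx; have uA := jacobian_unit X_open Gh Xk.
have GD := distortion_singular_values n_gt0 uA (L1_bound (u k) By).
have L1_ge0 := distortion_ge0 GD.
split.
  rewrite big_ord_recr mulrDr.
  apply: (jacobian_lip_comp _ _ uP uA kD _ L2_ge0 kL (L2_lip _ By)).
  - by apply: filterS (nX _ Xx) => y /kg[].
  - by apply: filterS (nX _ Xk) => y /Gh[].
  - by rewrite mulr_ge0 // sumr_ge0 // => i _; rewrite exprn_ge0.
have -> : jacobian (fun x => psi G k.+1 x u) x =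
    jacobian (fun x => psi G k x u) x *m jacobian (G^~ (u k)) (psi G k x u).
  exact: (jacobian_comp dk dG).
rewrite exprS; exact: distortion_mulmx.
Unshelve. all: by end_near. Qed.

End Iteration.

Unset Implicit Arguments.

Theorem mainTheorem3 (R : realType) (n : nat) (U : Type) (X : set 'rV[R]_n)
  (G : 'rV[R]_n -> U -> 'rV[R]_n) (N : nat) (r : R) (Omega : set 'rV[R]_n)
  (L1 L2 : R)
  (n_ge2 : (2 <= n)%N)
  (X_open : open X)
  (G_X : forall x w, X x -> X (G x w))
  (G_diffeo : forall w, exists Y : set 'rV[R]_n,
    [/\ open Y, Y `<=` X & C1_diffeo X Y (fun x => G x w)])
  (G_C11 : forall w, C11_on X (fun x => G x w))
  (N_gt0 : (0 < N)%N)
  (r_gt0 : 0 < r)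
  (Omega_X : Omega `<=` X)
  (Omega_rconvex : r_convex r Omega)
  (Omega_proper : Omega <> setT)
  (L1_bound : forall x w, psi_before G N Omega x ->
    alpha_max (jacobian (fun y => G y w) x) ^+ 2 /
      alpha_min (jacobian (fun y => G y w) x) <= L1)
  (L2_bound : forall x w, psi_before G N Omega x ->
    ((limf_esup (fun h : 'rV[R]_n =>
        (opnorm (jacobian (fun y => G y w) (x + h) *m
                   invmx (jacobian (fun y => G y w) x) - 1%:M) /
           enorm h)%:E)
      ((0 : 'rV[R]_n)^'))%R <= L2%:E)%E)
  (HrL : r * L2 * \sum_(tau < N) L1 ^+ tau <= 1) :
  forall (k : nat) (u : nat -> U), (k <= N)%N ->
    convex_set [set psi G k x u | x in Omega].
Proof.
move=> k u kN.
have n_gt0 : (0 < n)%N by exact: ltnW.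
have G_inverse w : exists g, local_inverse X (G^~ w) g.
  have [Y [Y_open YX GY]] := G_diffeo w.
  exact: C1_diffeo_local_inverse Y_open YX GY.
have [M OmegaE] := Omega_rconvex.
have {}OmegaE : Omega = ball_cap M r by [].
have M_neq0 : M !=set0.
  apply/set0P/eqP => M0; apply: Omega_proper.
  by rewrite OmegaE M0 /ball_cap bigcap_set0.
(* With [K] for [L2] the bounds persist, and so does the condition on [r]: its
   left hand side is [0] if [K] differs from [L2]. *)
pose K := Num.max L2 0.
have K_ge0 : 0 <= K by rewrite le_max lexx orbT.
have K_lip x w : psi_before G N Omega x -> jacobian_lip (G^~ w) K x.
  move=> Bx; have [g Gg] := G_inverse w.
  have Xx : X x.
    have [j [x0 [v [_ Ox0 ->]]]] := Bx.
    by have [h jh] := psi_local_inverse X_open G_inverse j v;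
       have [] := jh _ (Omega_X _ Ox0).
  apply: (@jacobian_lip_le _ _ _ L2); first by rewrite le_max lexx.
  by apply: jacobian_lip_limsup; [exact: jacobian_unit Gg _ Xx|exact: L2_bound].
have Omega_lip x : Omega x ->
    jacobian_lip (fun x => psi G k x u) (K * \sum_(i < k) L1 ^+ i) x.
  exact: (psi_jacobian_lip n_gt0 X_open G_inverse Omega_X K_ge0 L1_bound K_lip).
have [g kg] := psi_local_inverse X_open G_inverse k u.
move=> _ _ l /set_mem[x Ox <-] /set_mem[y Oy <-]; apply/mem_set.
have L1_ge0 : 0 <= L1.
  have Bx : psi_before G N Omega x by exists 0%N, x, u.
  have [h Gh] := G_inverse (u 0%N).
  have uA := jacobian_unit X_open Gh (Omega_X _ Ox).
  exact: distortion_ge0 (distortion_singular_values n_gt0 uA (L1_bound x _ Bx)).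
have S_ge0 m : 0 <= \sum_(i < m) L1 ^+ i.
  by apply: sumr_ge0 => i _; exact: exprn_ge0.
have S_le : \sum_(i < k) L1 ^+ i <= \sum_(i < N) L1 ^+ i.
  rewrite -(subnKC kN) big_split_ord /= lerDl.
  by apply: sumr_ge0 => i _; exact: exprn_ge0.
have rK : r * (K * \sum_(i < k) L1 ^+ i) <= 1.
  apply: (@le_trans _ _ (r * (K * \sum_(i < N) L1 ^+ i))).
    by rewrite ler_pM2l // ler_wpM2l.
  rewrite /K; have [_|_] := leP L2 0; first by rewrite mul0r mulr0.
  by rewrite mulrA.
rewrite OmegaE in Ox Oy Omega_X Omega_lip *.
have l01 : 0 <= 1 - l%:num <= 1.
  by rewrite subr_ge0 lerBlDr lerDl ge0 le1.
have H := segment_image X_open kg M_neq0 Omega_X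
  (mulr_ge0 K_ge0 (S_ge0 k)) rK Omega_lip Ox Oy l01.
rewrite [X in _ X](_ : _ = psi G k x u +
  (1 - l%:num) *: (psi G k y u - psi G k x u)) //.
rewrite /conv /= [in RHS]scalerBr [RHS]addrCA [RHS]addrC; congr (_ + _).
by rewrite scalerBl scale1r subKr.
Qed.
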